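(* For each $n\in\mathbb{N}_0$ there exists a unique linear map $V_n:\mathcal{H}_\infty\to\mathcal{H}_\infty^{(n)}$ such that for every $s\in X_{\mathrm{fin}}$, $$V_nk_s=\bigl(k_{\varphi_w(s)}\bigr)_{w\in W_n}.$$ Moreover, $V_n$ is an isometry, hence $\|V_nf\|=\|f\|$ for all $f\in\mathcal{H}_\infty$.
   Context: Let $\mathbb{N}_0=\{0,1,2,\dots\}$, let $X$ be a set, $m\ge1$ an integer, and $\varphi_1,\dots,\varphi_m:X\to X$ maps. A kernel $J:Y\times Y\to\mathbb{C}$ on a set $Y$ is positive definite if $\sum_{\alpha,\beta}\overline{c_\alpha}c_\beta J(s_\alpha,s_\beta)\ge0$ for all finite families $(c_\alpha,s_\alpha)\in\mathbb{C}\times Y$; $J_1\le J_2$ means that $J_2-J_1$ is positive definite. The pullback operator is $(LJ)(s,t):=\sum_{i=1}^m J(\varphi_i(s),\varphi_i(t))$. Fix a positive definite kernel $K$ on $X$ with $LK\ge K$. Set $K_0:=K$, $K_{n+1}:=LK_n$, $u_n(s):=K_n(s,s)$ (nondecreasing in $n$), $u_\infty(s):=\lim_nu_n(s)\in[0,\infty]$, $X_{\mathrm{fin}}:=\{s\in X:u_\infty(s)<\infty\}$. Each $\varphi_i$ maps $X_{\mathrm{fin}}$ into itself. For $s,t\in X_{\mathrm{fin}}$ the limit $K_\infty(s,t):=\lim_nK_n(s,t)$ exists; $K_\infty$ is positive definite on $X_{\mathrm{fin}}$ and $LK_\infty=K_\infty$ there. Words: $W_n:=\{1,\dots,m\}^n$,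 $W_0=\{\emptyset\}$; for $w=i_1\cdots i_n\in W_n$, $\varphi_w:=\varphi_{i_n}\circ\cdots\circ\varphi_{i_1}$ ($\varphi_\emptyset=\mathrm{id}$). $\mathcal{H}_\infty:=\mathcal{H}(K_\infty)$ is the reproducing kernel Hilbert space of $K_\infty$ on $X_{\mathrm{fin}}$, with kernel sections $k_s:=K_\infty(\cdot,s)$, so $\langle f,k_s\rangle=f(s)$ for $f\in\mathcal{H}_\infty$. $\mathcal{H}_\infty^{(n)}:=\bigoplus_{w\in W_n}\mathcal{H}_\infty$ is the Hilbert direct sum, with inner product $\langle(f_w)_{w\in W_n},(g_w)_{w\in W_n}\rangle:=\sum_{w\in W_n}\langle f_w,g_w\rangle$; in particular $\mathcal{H}^{(0)}_\infty=\mathcal{H}_\infty$.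
   Formalization: Uniqueness of V_n is asserted among bounded linear maps; among all linear maps it fails whenever the kernel sections k_s do not span H_∞ algebraically (e.g. K the delta kernel on an infinite X, m=1, φ_1=id). *)

(* Defs.v *)
From HB Require Import structures.
From mathcomp Require Import all_boot all_order all_algebra.
From mathcomp Require Import sesquilinear complex.
From mathcomp Require Import all_classical all_reals all_analysis.

Set Implicit Arguments.
Unset Strict Implicit.
Unset Printing Implicit Defensive.

Import Order.TTheory GRing.Theory Num.Theory.
Import numFieldNormedType.Exports.

Local Open Scope classical_set_scope.
Local Open Scope ring_scope.

Definition ckernel (R : realType) (Y : Type) := Y -> Y -> R[i].

(* In R[i], 0 <= z means that z is real and nonnegative. *)
Definition pd_kernel (R : realType) (Y : Type) (J : ckernel R Y) : Prop :=
  forall (N : nat) (c : 'I_N -> R[i]) (s : 'I_N -> Y),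
    0 <= \sum_(a < N) \sum_(b < N) (c a)^* * c b * J (s a) (s b).

Definition kernel_le (R : realType) (Y : Type) (J1 J2 : ckernel R Y) : Prop :=
  pd_kernel (fun s t => J2 s t - J1 s t).

Section Pullback.
Variables (R : realType) (X : Type) (m : nat) (phi : 'I_m -> X -> X).

Definition pullback (J : ckernel R X) : ckernel R X :=
  fun s t => \sum_(i < m) J (phi i s) (phi i t).

Variable K : ckernel R X.

Definition Kn (n : nat) : ckernel R X := iter n pullback K.

(* The diagonal values are real for the kernels of interest; Re is only the
   projection to R. *)
Definition u_ (n : nat) (s : X) : R := complex.Re (Kn n s s).

Definition u_oo (s : X) : \bar R := limn (fun n => (u_ n s)%:E).

Definition X_fin : set X := [set s | (u_oo s < +oo)%E].

Definition K_oo : ckernel R X_fin :=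
  fun s t => limn (fun n => Kn n (\val s) (\val t) : R[i]^o).

(* phi_w = phi_{i_n} \o ... \o phi_{i_1}: the first letter acts first. *)
Definition phiw (w : seq 'I_m) (s : X) : X := foldl (fun x i => phi i x) s w.

Lemma pd_pullback (J : ckernel R X) : pd_kernel J -> pd_kernel (pullback J).
Proof.
move=> hJ N c s; rewrite /pullback.
have -> : \sum_(a < N) \sum_(b < N) (c a)^* * c b *
            (\sum_(i < m) J (phi i (s a)) (phi i (s b))) =
          \sum_(i < m) \sum_(a < N) \sum_(b < N) (c a)^* * c b *
            J (phi i (s a)) (phi i (s b)).
  rewrite [RHS]exchange_big; apply: eq_bigr => a _.
  rewrite [RHS]exchange_big; apply: eq_bigr => b _.
  by rewrite mulr_sumr.
by apply: sumr_ge0 => i _; exact: hJ.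
Qed.

Lemma pd_diag (Y : Type) (J : ckernel R Y) s : pd_kernel J -> 0 <= J s s.
Proof.
move=> /(_ 1 (fun=> 1) (fun=> s)).
by rewrite !big_ord1 conjC1 !mul1r.
Qed.

Lemma Re_ge0 (z : R[i]) : 0 <= z -> 0 <= complex.Re z.
Proof. by case: z => a b; rewrite lecE /= => /andP[]. Qed.

Hypotheses (hK : pd_kernel K) (hLK : kernel_le K (pullback K)).

Lemma pd_Kn n : pd_kernel (Kn n).
Proof. by elim: n => //= n; exact: pd_pullback. Qed.

Lemma Kn_le n : kernel_le (Kn n) (Kn n.+1).
Proof.
elim: n => // n ih; have := pd_pullback ih; rewrite /kernel_le.
suff -> : pullback (fun s t => Kn n.+1 s t - Kn n s t) =
          (fun s t => Kn n.+2 s t - Kn n.+1 s t) by [].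
by apply/funext => s; apply/funext => t; rewrite /pullback sumrB.
Qed.

Lemma u_ge0 n s : 0 <= u_ n s.
Proof. by apply/Re_ge0/pd_diag; exact: pd_Kn. Qed.

Lemma nd_u s : {homo u_^~ s : n p / (n <= p)%N >-> n <= p}.
Proof.
apply/nondecreasing_seqP => n; rewrite -subr_ge0 /u_ -raddfB.
exact/Re_ge0/(pd_diag s (Kn_le n)).
Qed.

Lemma uS n s : u_ n.+1 s = \sum_(i < m) u_ n (phi i s).
Proof. by rewrite /u_ -raddf_sum. Qed.

Lemma cvg_u s : cvgn (fun n => (u_ n s)%:E).
Proof.
by apply: ereal_nondecreasing_is_cvgn => a b ab; rewrite lee_fin nd_u.
Qed.

Lemma X_fin_phi i s : X_fin s -> X_fin (phi i s).
Proof.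
rewrite /X_fin /=; apply: le_lt_trans.
have h : (fun n => (u_ n.+1 s)%:E) @ \oo --> u_oo s.
  by rewrite (cvg_shiftS (fun n => (u_ n s)%:E)); exact: cvg_u.
rewrite -(cvg_lim _ h)//; apply: lee_lim; first exact: cvg_u.
  by apply/cvg_ex; exists (u_oo s).
apply: nearW => n; rewrite lee_fin uS (bigD1 i) //= lerDl.
by rewrite sumr_ge0 // => j _; exact: u_ge0.
Qed.

Lemma X_fin_phiw w s : X_fin s -> X_fin (phiw w s).
Proof. by elim: w s => //= i w ih s /(X_fin_phi i); exact: ih. Qed.

Definition phiw_fin (w : seq 'I_m) (s : X_fin) : X_fin :=
  exist _ (phiw w (\val s)) (mem_set (X_fin_phiw w (set_mem (valP s)))).

End Pullback.

Arguments K_oo {R X m} phi K _ _.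

Section HilbertSum.
Variables (R : realType) (U : lmodType R[i]) (T : finType).

Definition hnorm (d : {dot U for Num.conj}) (f : U) : R[i] := sqrtC (d f f).

Variable d : {dot U for Num.conj}.

Definition hsum_dot (f g : {ffun T -> U}) : R[i] := \sum_(w : T) d (f w) (g w).

Let hsum_dot_bilinear : bilinear_for *%R (Num.conj \; *%R) hsum_dot.
Proof.
split=> u a f g; rewrite /hsum_dot /= mulr_sumr -big_split; apply: eq_bigr.
  by move=> w _; rewrite !ffunE linearPl.
by move=> w _; rewrite !ffunE linearPr.
Qed.

HB.instance Definition _ := bilinear_isBilinear.Build R[i] _ _ _ _ _ hsum_dot
  hsum_dot_bilinear.

Let hsum_dot_herm f g : hsum_dot f g = (-1) ^+ false * (hsum_dot g f)^*.
Proof.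
rewrite mul1r /hsum_dot rmorph_sum; apply: eq_bigr => w _ /=.
by rewrite hermC /= mul1r.
Qed.

HB.instance Definition _ := isHermitianSesquilinear.Build R[i] _ false
  (Num.conj : R[i] -> R[i]) hsum_dot hsum_dot_herm.

Let hsum_dot_gt0 f : f != 0 -> 0 < hsum_dot f f.
Proof.
move=> f0; have [w fw] : exists w, f w != 0.
  apply/existsP; apply: contraNT f0 => /existsPn h.
  by apply/eqP/ffunP => w; rewrite ffunE; apply/eqP; rewrite -[_ == _]negbK h.
rewrite /hsum_dot (bigD1 w) //=; apply: ltr_wpDr; last exact: neq0_dnorm_gt0.
by apply: sumr_ge0 => v _; exact: dnorm_ge0.
Qed.

HB.instance Definition _ := isDotProduct.Build R[i] _ hsum_dot hsum_dot_gt0.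

End HilbertSum.

(* A reproducing kernel Hilbert space of K on Y.  Its elements are identified
   with functions on Y through the linear injection rkhs_eval; inner products
   are linear in the first argument. *)
Record rkhs (R : realType) (Y : Type) (K : ckernel R Y) := Rkhs {
  rkhs_space :> completeNormedModType R[i];
  rkhs_dot : {dot rkhs_space for Num.conj};
  rkhs_normE : forall f : rkhs_space, `|f| = hnorm rkhs_dot f;
  rkhs_eval : {linear rkhs_space -> (Y -> R[i])};
  rkhs_eval_inj : injective rkhs_eval;
  rkhs_section : Y -> rkhs_space;
  rkhs_sectionE : forall s t, rkhs_eval (rkhs_section s) t = K t s;
  rkhs_reproducing : forall f s, rkhs_dot f (rkhs_section s) = rkhs_eval f s
}.

Definition hilbert_sum (R : realType) (Y : Type) (K : ckernel R Y) (H : rkhs K)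
  (T : finType) : lmodType R[i] := {ffun T -> H}.

Definition hilbert_sum_dot (R : realType) (Y : Type) (K : ckernel R Y)
    (H : rkhs K) (T : finType) : {dot hilbert_sum H T for Num.conj} :=
  hsum_dot (T := T) (@rkhs_dot R Y K H).

Definition bounded_linear_op (R : realType) (Y : Type) (K : ckernel R Y) (H : rkhs K)
    (T : finType) (V : H -> hilbert_sum H T) : Prop :=
  linear V /\
  exists M : R, forall f : H, hnorm (hilbert_sum_dot H T) (V f) <= (M%:C)%C * `|f|.

(* Main.v *)
From HB Require Import structures.
Require Import Defs.
From mathcomp Require Import all_boot all_order all_algebra.
From mathcomp Require Import sesquilinear complex.
From mathcomp Require Import all_classical all_reals all_analysis.
From mathcomp Require Import ring.

Set Implicit Arguments.
Unset Strict Implicit.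
Unset Printing Implicit Defensive.

Import Order.TTheory GRing.Theory Num.Theory.
Import numFieldNormedType.Exports.

Local Open Scope ring_scope.
Local Open Scope classical_set_scope.

(** The map [V] is the extension by linearity and continuity of its values on
    the kernel sections.  Three facts make this work.

    The Gram matrices agree.  Unfolding the pullback [n] times turns
    [K_(n+k) (s, t)] into the sum, over the words [w] of length [n], of
    [K_k (phi_w s, phi_w t)], and [k -> oo] gives the same identity for [K_oo]
    ([K_oo_words]).  The left-hand side is [<k_t, k_s>], the right-hand side is
    the inner product in the direct sum of the families prescribed for [V k_t]
    and [V k_s].  Passing to the limit requires the convergence of
    [K_n (s, t)] off the diagonal; polarization reduces it to quadratic
    expressions, which are nondecreasing in [n] because [K_(n+1) - K_n] is
    positive definite, and bounded on [X_fin] ([quad_cvg]).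

    The sections are total.  By the reproducing property a vector orthogonal to
    every section vanishes as a function, hence is zero.  In a Hilbert space a
    subspace with trivial orthogonal complement is dense: a minimizing sequence
    for the distance to it converges by the parallelogram law, and the
    remainder is orthogonal to the subspace ([dense_of_trivial_orthogonal]).

    Contractions extend.  Equality of Gram matrices says that
    [sum c_j k_(s_j) |-> sum c_j h (s_j)] preserves inner products, so each of
    its coordinates is a well-defined contraction on a dense subspace, and
    extends to the whole space by completeness ([contraction_extension]).  The
    isometry identity for the extension, and the uniqueness of a bounded
    extension, are equalities of Lipschitz functions on a dense set
    ([lipschitz_eq0]). *)

(** * A form of completeness *)

(** Completeness in the shape of Cantor's intersection theorem: [A e] is the set
    of the approximations of precision [e] to a point still to be found.
    Minimizing sequences and extensions by continuity are both instances, and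
    no sequence has to be chosen. *)
Lemma coherent_approximations_cvg (K : numFieldType)
    (V : completeNormedModType K) (A : K -> set V) :
  (forall e, 0 < e -> A e !=set0) ->
  (forall e e' u v, 0 < e -> 0 < e' -> A e u -> A e' v -> `|u - v| <= e + e') ->
  exists p, forall e u, 0 < e -> A e u -> `|p - u| <= e.
Proof.
move=> A0 Adist.
pose F : set_system V :=
  [set B | exists2 e, 0 < e & forall e', 0 < e' -> e' <= e -> A e' `<=` B].
(* The sets [A e] need not be nested, hence the quantification over all smaller
   precisions in F. *)
have FF : ProperFilter F.
  split.
    by move=> [e e0 /(_ e e0 (lexx _))]; have [u Au] := A0 _ e0 => /(_ u Au).
  split.
  - by exists 1.
  - move=> P Q [e e0 eP] [e1 e10 eQ].
    have ee1 : e >=< e1 by apply: real_comparable; exact: gtr0_real.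
    exists (Order.min e e1); first by rewrite comparable_lt_min // e0.
    move=> e' e'0; rewrite comparable_le_min // => /andP[le le1] u Au.
    by split; [apply: eP Au|apply: eQ Au].
  - by move=> P Q PQ [e e0 eP]; exists e => // e' e'0 /(eP _ e'0) /subset_trans; apply.
have /cauchy_cvg Fcvg : cauchy F.
  apply: cauchy_exP => e e0; have e4 : 0 < e / 2 / 2 by rewrite !divr_gt0.
  have [x Ax] := A0 _ e4; exists x, (e / 2 / 2) => // e' e'0 le u Au.
  rewrite -ball_normE /ball_ /=; apply: (le_lt_trans (Adist _ _ _ _ e4 e'0 Ax Au)).
  apply: (le_lt_trans (lerD (lexx _) le)).
  by rewrite -splitr gtr_pMr // invf_lt1 // ltr1n.
have /cvg_ex[p Fp] := Fcvg.
exists p => e u e0 Au; apply/ler_addgt0Pr => eta eta0.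
have eta2 : 0 < eta / 2 by rewrite divr_gt0.
have [d d0 dB] : F (ball p (eta / 2)) by apply: Fp; exact: nbhsx_ballx.
have cd : d >=< eta / 2 by apply: real_comparable; exact: gtr0_real.
have m0 : 0 < Order.min d (eta / 2) by rewrite comparable_lt_min // d0.
have [v Av] := A0 _ m0.
have pv : `|p - v| < eta / 2.
  by have := dB _ m0 _ _ Av; rewrite -ball_normE; apply; rewrite comparable_ge_min // lexx.
have -> : e + eta = eta / 2 + (eta / 2 + e) by rewrite addrA -splitr addrC.
apply: (le_trans (ler_distD v p u)); apply: lerD; first exact: ltW.
apply: (le_trans (Adist _ _ _ _ m0 e0 Av Au)); rewrite lerD2r.
by rewrite comparable_ge_min // lexx orbT.
Qed.

(** * Extension from dense sets *)

Section DenseSets.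
Variables (K : numFieldType) (V : normedModType K).

Definition dense_in (D : set V) :=
  forall f e, 0 < e -> exists2 g, D g & `|f - g| <= e.

Section Extension.
Variables (W : completeNormedModType K) (G : set (V * W)).
Hypothesis G0 : G (0, 0).
Hypothesis Glin : forall a x y, G x -> G y -> G (a *: x + y).
Hypothesis Gcontr : forall x, G x -> `|x.2| <= `|x.1|.
Hypothesis Gdense : dense_in [set x.1 | x in G].

(** The partial map is given by its graph [G], which spares the verification
    that it is single-valued: that follows from the contraction property.  The
    value at [f] is the point approximated by [y] to within [`|f - x|] for all
    [(x, y)] in [G]; linearity is inherited from [G] by approximation. *)
Lemma contraction_extension : exists T : V -> W,
  [/\ linear T, forall f, `|T f| <= `|f| & forall x, G x -> T x.1 = x.2].
Proof.
have GB x y : G x -> G y -> G (x - y).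
  by move=> Gx Gy; rewrite -scaleN1r addrC; exact: Glin.
have ex f : exists F, forall x, G x -> `|F - x.2| <= `|f - x.1|.
  pose A (e : K) := [set x.2 | x in [set x | G x /\ `|f - x.1| <= e]].
  have [|e e' _ _ e0 e'0 [x [Gx lx] <-] [y [Gy ly] <-]|F FA] :=
      @coherent_approximations_cvg _ W A.
  - move=> e /(Gdense f)[_ [x Gx <-] le].
    by exists x.2, x.
  - have := Gcontr (GB _ _ Gx Gy) => /= /le_trans; apply.
    apply: (le_trans (ler_distD f _ _)); apply: lerD => //.
    by rewrite distrC.
  - exists F => x Gx; apply/ler_addgt0Pr => e e0; apply: FA.
      by rewrite ltr_wpDl.
    by exists x => //; split=> //; rewrite lerDl ltW.
have [T TP] := choice ex.
exists T; split.
- move=> a f g; apply/eqP; rewrite -subr_eq0 -normr_eq0 eq_le normr_ge0 andbT.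
  apply/ler_addgt0Pr => e e0; rewrite add0r.
  pose c := `|a| + 1; have c0 : 0 < c by rewrite ltr_wpDl.
  (* [T] commutes with the combination up to [c * e'] on each side. *)
  pose e' := e / (2 * c).
  have e'0 : 0 < e' by rewrite divr_gt0 // mulr_gt0.
  have [_ [x Gx <-] fx] := Gdense f e'0.
  have [_ [y Gy <-] gy] := Gdense g e'0.
  have comb (U : normedModType K) (u v u' v' : U) :
      `|u - u'| <= e' -> `|v - v'| <= e' ->
      `|a *: u + v - (a *: u' + v')| <= c * e'.
    move=> uu' vv'.
    rewrite opprD addrACA -scalerBr mulrDl mul1r.
    apply: (le_trans (ler_normD _ _)); apply: lerD => //.
    by rewrite normrZ ler_wpM2l.
  have h1 := le_trans (TP _ _ (Glin a Gx Gy)) (comb _ _ _ _ _ fx gy).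
  have h2 := comb _ _ _ _ _ (le_trans (TP _ _ Gx) fx) (le_trans (TP _ _ Gy) gy).
  have -> : e = c * e' + c * e' by rewrite /e'; field; rewrite gt_eqF.
  apply: (le_trans (ler_distD (a *: x.2 + y.2) _ _)); apply: lerD => //.
  by rewrite distrC.
- by move=> f; have := TP f _ G0; rewrite /= !subr0.
- move=> x Gx; apply/eqP; rewrite -subr_eq0 -normr_eq0 eq_le normr_ge0 andbT.
  by have := TP x.1 _ Gx; rewrite subrr normr0.
Qed.

End Extension.

Lemma lipschitz_eq0 (W : normedModType K) (D : set V) (phi : V -> W) (C : K) :
  dense_in D -> 0 <= C -> (forall f g, `|phi f - phi g| <= C * `|f - g|) ->
  (forall g, D g -> phi g = 0) -> forall f, phi f = 0.
Proof.
move=> Ddense C0 philip phi0 f.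
apply/eqP; rewrite -normr_eq0 eq_le normr_ge0 andbT.
apply/ler_addgt0Pr => e e0; rewrite add0r.
have C1 : 0 < C + 1 by rewrite ltr_wpDl.
have [|g Dg fg] := Ddense f (e / (C + 1)); first by rewrite divr_gt0.
rewrite -[phi f]subr0 -(phi0 _ Dg); apply: (le_trans (philip _ _)).
apply: (@le_trans _ _ (C * (e / (C + 1)))); first by rewrite ler_wpM2l.
by rewrite mulrCA ler_piMr ?(ltW e0) // ler_pdivrMr // mul1r lerDl.
Qed.

End DenseSets.

(** * Near-minimality and orthogonality *)

Section DotTheory.
Variables (C : numClosedFieldType) (U : lmodType C) (form : {dot U for Num.conj}).
Local Notation "''[' u , v ]" := (form u%R v%R) : ring_scope.
Local Notation "''[' u ]" := '[u, u]%R : ring_scope.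

(** Optimizing over [a] the hypothesis yields the inequality: the minimum of
    ['[r - a *: k]] is ['[r] - `|'[r, k]| ^+ 2 / '[k]].  With [e = '[r]] the
    hypothesis is void and this is the Cauchy-Schwarz inequality; with small [e]
    it says that the remainder of a nearly best approximation is nearly
    orthogonal. *)
Lemma near_minimal_near_orthogonal (r k : U) (e : C) :
  (forall a, '[r] <= '[r - a *: k] + e) -> `|'[r, k]| ^+ 2 <= e * '[k].
Proof.
have [-> _|k0] := eqVneq k 0; first by rewrite !raddf0 normr0 expr0n mulr0.
have kk0 : 0 < '[k] by rewrite dnorm_gt0.
move=> /(_ ('[r, k] / '[k])).
have -> : '[r - ('[r, k] / '[k]) *: k] = '[r] - `|'[r, k]| ^+ 2 / '[k].
  rewrite dnormB dnormZ linearZr_LR /=.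
  rewrite normf_div (ger0_norm (ltW kk0)) fmorph_div /=.
  rewrite (geC0_conj (ltW kk0)) -[_^* / _ * _]mulrAC -normCKC rmorphM fmorphV /=.
  rewrite (geC0_conj (ltW kk0)) [X in _ - (_ + X / _)]geC0_conj ?exprn_ge0 //.
  by field; rewrite gt_eqF.
by rewrite -addrA lerDl addrC subr_ge0 ler_pdivrMr.
Qed.

Lemma dot_CauchySchwarz (u v : U) : `|'[u, v]| <= sqrtC '[u] * sqrtC '[v].
Proof.
rewrite -(@ler_pXn2r _ 2) ?nnegrE ?mulr_ge0 ?sqrtC_ge0 ?dnorm_ge0 // exprMn !sqrtCK.
apply: near_minimal_near_orthogonal => a.
by rewrite lerDr dnorm_ge0.
Qed.

Lemma parallelogram (u v : U) : '[u + v] + '[u - v] = '[u] *+ 2 + '[v] *+ 2.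
Proof. by rewrite dnormD dnormB; ring. Qed.

End DotTheory.

(** * Formal linear combinations *)

Section LinearCombinations.
Variables (K : nzRingType) (S : Type).

(** Keeping the combination [x] apart from the family [k] allows the same
    coefficients to be applied to two families, which is how the graph of a
    partial linear map is described below. *)
Definition lincomb (U : lmodType K) (k : S -> U) (x : seq (K * S)) : U :=
  \sum_(p <- x) p.1 *: k p.2.

Definition scale_cat (a : K) (x y : seq (K * S)) : seq (K * S) :=
  [seq (a * p.1, p.2) | p <- x] ++ y.

Lemma lincombP (U : lmodType K) (k : S -> U) a x y :
  lincomb k (scale_cat a x y) = a *: lincomb k x + lincomb k y.
Proof.
rewrite /lincomb big_cat big_map /= scaler_sumr; congr (_ + _).
by apply: eq_bigr => p _; rewrite scalerA.
Qed.

Lemma lincomb1 (U : lmodType K) (k : S -> U) s : lincomb k [:: (1, s)] = k s.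
Proof. by rewrite /lincomb big_seq1 scale1r. Qed.

Lemma lincomb_linear (U W : lmodType K) (k : S -> U) (f : {linear U -> W}) x :
  f (lincomb k x) = lincomb (f \o k) x.
Proof. by rewrite linear_sum; apply: eq_bigr => p _; rewrite linearZ. Qed.

End LinearCombinations.

Lemma dot_lincomb (C : numClosedFieldType) (S : Type) (U : lmodType C)
    (form : {dot U for Num.conj}) (k : S -> U) (x y : seq (C * S)) :
  form (lincomb k x) (lincomb k y) =
  \sum_(p <- x) \sum_(q <- y) p.1 * (q.1)^* * form (k p.2) (k q.2).
Proof.
rewrite linear_sumlz; apply: eq_bigr => p _.
rewrite linear_sumr; apply: eq_bigr => q _.
by rewrite linearZl_LR linearZr_LR mulrA.
Qed.

(** * Hilbert spaces *)

Section HilbertSpace.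
Variables (R : realType) (H : completeNormedModType R[i]).
Variable d : {dot H for Num.conj}.
Hypothesis normE : forall f : H, `|f| = hnorm d f.
Local Notation "''[' u , v ]" := (d u%R v%R) : ring_scope.
Local Notation "''[' u ]" := '[u, u]%R : ring_scope.

Lemma dnormE (f : H) : '[f] = `|f| ^+ 2.
Proof. by rewrite normE sqrtCK. Qed.

Lemma norm_dot_le (f g : H) : `|'[f, g]| <= `|f| * `|g|.
Proof. by rewrite !normE; exact: dot_CauchySchwarz. Qed.

(** The infimum is taken in [R], where it exists, and squared distances in
    [R[i]] are recovered from their real parts. *)
Lemma minimal_distance (D : set H) (f : H) : D !=set0 ->
  exists delta : R[i], (forall g, D g -> delta <= '[f - g]) /\
    forall e, 0 < e -> exists2 g, D g & '[f - g] <= delta + e.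
Proof.
move=> [g0 Dg0].
pose E : set R := [set complex.Re '[f - g] | g in D].
have ReE g : (complex.Re '[f - g])%:C%C = '[f - g].
  by apply/RRe_real/ger0_real/dnorm_ge0.
have hE : has_inf E.
  split; first by exists (complex.Re '[f - g0]), g0.
  by exists 0 => _ [g _ <-]; apply/Re_ge0/dnorm_ge0.
exists ((inf E)%:C)%C; split.
  by move=> g Dg; rewrite -ReE lecR; apply: ge_inf; [exact: hE.2|exists g].
move=> e e0; have eE : (complex.Re e)%:C%C = e by apply/RRe_real/gtr0_real.
have Re0 : 0 < complex.Re e by rewrite -ltcR eE.
have [_ [g Dg <-] lt] := inf_adherent Re0 hE.
by exists g => //; rewrite -ReE -eE -raddfD lecR ltW.
Qed.

(** This replaces the orthogonal projection onto the closure of [D].  The nearly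
    best approximations of [f] in [D] are coherent by the parallelogram law,
    since the midpoint of two of them is again in [D]; their limit [p] satisfies
    [f - p] orthogonal to [D], so [f = p]. *)
Lemma dense_of_trivial_orthogonal (D : set H) : D 0 ->
  (forall a f g, D f -> D g -> D (a *: f + g)) ->
  (forall f, (forall g, D g -> '[f, g] = 0) -> f = 0) -> dense_in D.
Proof.
move=> D0 Dlin Dperp f.
have [delta [deltaP deltaE]] : exists delta : R[i], (forall g, D g -> delta <= '[f - g]) /\
    forall e, 0 < e -> exists2 g, D g & '[f - g] <= delta + e.
  by apply: minimal_distance; exists 0.
(* The excess [e ^+ 2 / 2] makes the parallelogram law give a squared distance
   of at most [e ^+ 2 + e' ^+ 2]. *)
pose A (e : R[i]) := [set g | D g /\ '[f - g] <= delta + e ^+ 2 / 2].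
have A0 e : 0 < e -> A e !=set0.
  move=> e0; have [|g Dg le] := deltaE (e ^+ 2 / 2); last by exists g.
  by rewrite divr_gt0 // exprn_gt0.
have [p pA] : exists p, forall e u, 0 < e -> A e u -> `|p - u| <= e.
  apply: coherent_approximations_cvg => // e e' u v e0 e'0 [Du lu] [Dv lv].
  rewrite -(@ler_pXn2r _ 2) ?nnegrE ?addr_ge0 ?(ltW e0) ?(ltW e'0) // -dnormE.
  (* The midpoint of u and v, written as the closure property of D requires. *)
  pose w := 2^-1 *: u + (2^-1 *: v + 0).
  have Dw : D w by apply: (Dlin) => //; apply: (Dlin).
  have := parallelogram d (f - u) (f - v).
  have -> : f - u + (f - v) = 2 *: (f - w).
    rewrite /w addr0 -scalerDr scalerBr scalerA divff // scale1r.
    by rewrite scaler_nat mulr2n opprD addrACA.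
  have -> : f - u - (f - v) = v - u by rewrite opprB addrC addrA subrK.
  rewrite dnormZ normr_nat => para.
  have -> : '[u - v] = ('[f - u] + '[f - v]) *+ 2 - 4 * '[f - w].
    by rewrite -opprB hnormN mulrnDl -para; ring.
  have ub : ('[f - u] + '[f - v]) *+ 2 - 4 * '[f - w] <=
            (delta + e ^+ 2 / 2 + (delta + e' ^+ 2 / 2)) *+ 2 - 4 * delta.
    apply: lerB; first by rewrite lerMn2r /= lerD.
    by rewrite ler_wpM2l // deltaP.
  apply: (le_trans ub).
  have -> : (delta + e ^+ 2 / 2 + (delta + e' ^+ 2 / 2)) *+ 2 - 4 * delta =
            e ^+ 2 + e' ^+ 2 by field.
  by rewrite sqrrD lerD2r lerDl mulrn_wge0 // mulr_ge0 // ltW.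
have fp : f - p = 0.
  apply: Dperp => g Dg; apply/eqP; rewrite -normr_eq0 eq_le normr_ge0 andbT.
  apply/ler_addgt0Pr => e e0; rewrite add0r.
  (* Both [f - u] and [p - u] contribute [e' * `|g|] below; the [+ 1] covers
     [g = 0]. *)
  pose e' := e / (2 * (`|g| + 1)).
  have g1 : 0 < `|g| + 1 by rewrite ltr_wpDl.
  have e'0 : 0 < e' by rewrite divr_gt0 // mulr_gt0.
  have [u Au] := A0 _ e'0; have [Du lu] := Au.
  have fu : `|'[f - u, g]| <= e' * `|g|.
    have e'g0 : 0 <= e' * `|g| by rewrite mulr_ge0 // ltW.
    rewrite -(@ler_pXn2r _ 2) ?nnegrE // exprMn -dnormE.
    apply: near_minimal_near_orthogonal => a.
    rewrite -addrA -opprD (addrC u); apply: (le_trans lu); apply: lerD.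
      by apply: deltaP; exact: Dlin.
    by rewrite ler_pdivrMr // ler_peMr // ?ler1n // exprn_ge0 // ltW.
  have -> : '[f - p, g] = '[f - u, g] - '[p - u, g].
    by rewrite -linearBl opprB addrA subrK.
  apply: (le_trans (ler_normB _ _)).
  apply: (@le_trans _ _ (e' * `|g| + e' * `|g|)).
    apply: lerD => //; apply: (le_trans (norm_dot_le _ _)).
    by rewrite ler_wpM2r // pA.
  rewrite -mulr2n -mulr_natr -mulrA /e' mulrAC ler_pdivrMr ?mulr_gt0 //.
  by rewrite ler_pM2l // mulrC ler_pM2l // lerDl.
move=> e e0; have [u Au] := A0 _ e0.
exists u; first exact: Au.1.
by rewrite -(subrK p f) fp add0r; exact: pA.
Qed.

Section GramIsometry.
Variables (S : Type) (k : S -> H).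
Hypothesis total : forall f, (forall s, '[f, k s] = 0) -> f = 0.

Lemma dense_lincomb : dense_in (range (lincomb k)).
Proof.
apply: dense_of_trivial_orthogonal.
- by exists [::] => //; rewrite /lincomb big_nil.
- by move=> a _ _ [x _ <-] [y _ <-]; rewrite -lincombP; exists (scale_cat a x y).
- move=> f f0; apply: total => s; apply: f0.
  by exists [:: (1, s)]; rewrite ?lincomb1.
Qed.

Variable T : finType.
Local Notation hs := (hsum_dot (T := T) d : {dot {ffun T -> H} for Num.conj}).

Lemma norm_component_le (F : {ffun T -> H}) w : `|F w| <= hnorm hs F.
Proof.
rewrite normE /hnorm ler_sqrtC ?nnegrE ?dnorm_ge0 //.
change (d (F w) (F w) <= \sum_v d (F v) (F v)).
rewrite (bigD1 w) //= lerDl.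
by apply: sumr_ge0 => v _; exact: dnorm_ge0.
Qed.

(** Density argument, carried out in each coordinate because only [H] itself
    carries a topology here. *)
Lemma bounded_eq_on_sections (V1 V2 : H -> {ffun T -> H}) (M1 M2 : R[i]) :
  linear V1 -> linear V2 ->
  (forall f, hnorm hs (V1 f) <= M1 * `|f|) ->
  (forall f, hnorm hs (V2 f) <= M2 * `|f|) ->
  (forall s, V1 (k s) = V2 (k s)) -> V1 = V2.
Proof.
move=> l1 l2 b1 b2 V12; apply/funext => f; apply/ffunP => w.
pose V1' : {linear H -> {ffun T -> H}} :=
  HB.pack V1 (GRing.isLinear.Build _ _ _ _ V1 l1).
pose V2' : {linear H -> {ffun T -> H}} :=
  HB.pack V2 (GRing.isLinear.Build _ _ _ _ V2 l2).
apply/eqP; rewrite -subr_eq0; apply/eqP.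
apply: (@lipschitz_eq0 _ H H (range (lincomb k)) (fun f => V1 f w - V2 f w)
  (`|M1| + `|M2|)).
- exact: dense_lincomb.
- by rewrite addr_ge0.
- have bnd (V : {linear H -> {ffun T -> H}}) M g h :
      (forall f, hnorm hs (V f) <= M * `|f|) ->
      `|V g w - V h w| <= `|M| * `|g - h|.
    move=> bV; have -> : V g w - V h w = V (g - h) w by rewrite raddfB !ffunE.
    apply: (le_trans (norm_component_le _ _)); apply: (le_trans (bV _)).
    have M0 : 0 <= M * `|g - h| by apply: le_trans (bV _); exact: sqrt_dnorm_ge0.
    by rewrite -[leLHS]ger0_norm // normrM normr_id.
  move=> g h; rewrite opprD addrACA -opprD mulrDl.
  apply: (le_trans (ler_normB _ _)).
  by apply: lerD; [exact: (bnd V1')|exact: (bnd V2')].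
- move=> _ [x _ <-].
  have -> : V1 (lincomb k x) = V2 (lincomb k x); last by rewrite subrr.
  rewrite [LHS](lincomb_linear k V1') [RHS](lincomb_linear k V2').
  by apply: eq_bigr => p _ /=; rewrite V12.
Qed.

Variable h : S -> {ffun T -> H}.
Hypothesis gram : forall s t, hs (h s) (h t) = '[k s, k t].

(** Equality of Gram matrices determines an isometry.  The direct sum carries no
    topology, so [V] is assembled from the extensions [Tw w] of its coordinates.
    Each coordinate is only a contraction; the isometry identity is recovered
    for the sum, first on combinations of sections, then by density in one
    argument after the other. *)
Lemma gram_isometry : exists V : H -> {ffun T -> H},
  [/\ linear V, forall s, V (k s) = h s & isometry hs d V].
Proof.
have gram' x y : hs (lincomb h x) (lincomb h y) = '[lincomb k x, lincomb k y].
  rewrite !dot_lincomb; apply: eq_bigr => p _; apply: eq_bigr => q _.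
  by rewrite gram.
have ex w : exists Tw : H -> H, [/\ linear Tw, forall f, `|Tw f| <= `|f| &
    forall x, Tw (lincomb k x) = lincomb h x w].
  pose G : set (H * H) := range (fun x => (lincomb k x, lincomb h x w)).
  have [| | | |Tw [lT bT TG]] := @contraction_extension _ H H G.
  - by exists [::] => //; rewrite /lincomb !big_nil ffunE.
  - move=> a _ _ [x _ <-] [y _ <-]; exists (scale_cat a x y) => //.
    by rewrite !lincombP !ffunE.
  - move=> _ [x _ <-] /=; apply: (le_trans (norm_component_le _ _)).
    by rewrite normE /hnorm gram'.
  - move=> f e /(dense_lincomb f)[_ [x _ <-] le].
    by exists (lincomb k x) => //; exists (lincomb k x, lincomb h x w) => //; exists x.
  exists Tw; split=> // x; apply: (TG (_, _)).
  by exists x.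
have [Tw TwP] := choice ex.
pose V f := [ffun w => Tw w f].
have lV : linear V.
  move=> a f g; apply/ffunP => w; rewrite !ffunE.
  by have [-> _ _] := TwP w.
pose V' : {linear H -> {ffun T -> H}} :=
  HB.pack V (GRing.isLinear.Build _ _ _ _ V lV).
have Vlin x : V (lincomb k x) = lincomb h x.
  by apply/ffunP => w; rewrite ffunE; have [_ _ ->] := TwP w.
have bV f : exists2 C, 0 <= C & forall g, `|hs (V f) (V g)| <= C * `|g|.
  exists (\sum_(w : T) `|V f w|); first exact: sumr_ge0.
  move=> g; rewrite mulr_suml; apply: (le_trans (ler_norm_sum _ _ _)).
  apply: ler_sum => w _; apply: (le_trans (norm_dot_le _ _)).
  by rewrite ler_wpM2l // ffunE; have [_ + _] := TwP w; apply.
have step f : (forall x, hs (V f) (V (lincomb k x)) = '[f, lincomb k x]) ->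
    forall g, hs (V f) (V g) = '[f, g].
  move=> fk g; have [C C0 hC] := bV f.
  apply/eqP; rewrite -subr_eq0; apply/eqP.
  apply: (lipschitz_eq0 (W := R[i]^o) (phi := fun g => hs (V f) (V g) - '[f, g])
    (C := C + `|f|) dense_lincomb).
  - by rewrite addr_ge0.
  - move=> u v; rewrite opprD addrACA -opprD mulrDl -!linearBr.
    apply: (le_trans (ler_normB _ _)); apply: lerD; last exact: norm_dot_le.
    have -> : V u - V v = V (u - v) by rewrite -[V]/(V' : H -> _) raddfB.
    exact: hC.
  - by move=> _ [x _ <-]; rewrite fk subrr.
exists V; split => //.
  by move=> s; rewrite -(lincomb1 k) -(lincomb1 h) Vlin.
move=> f; apply: (step f) => y.
rewrite [LHS]hermC [RHS]hermC /=; congr (_ * Num.conj _).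
apply: (step _) => x.
by rewrite !Vlin gram'.
Qed.

End GramIsometry.

End HilbertSpace.

(** * Limits of the iterated kernels *)

Section KernelLimits.
Variables (R : realType) (X : Type).

Lemma cvg_real_complex (x : nat -> R) (l : R) :
  x n @[n --> \oo] --> l -> ((x n)%:C%C : R[i]^o) @[n --> \oo] --> (l%:C%C : R[i]^o).
Proof.
move=> /cvgrPdist_lt xl; apply/cvgrPdist_lt => e e0.
have eE : (complex.Re e)%:C%C = e by apply/RRe_real/gtr0_real.
have Re0 : 0 < complex.Re e by rewrite -ltcR eE.
near=> n; rewrite -raddfB /= -eE.
have -> : `|((l - x n)%:C)%C| = (`|l - x n|%:C)%C by rewrite normc_def /= expr0n addr0 sqrtr_sqr.
by rewrite ltcR; near: n; exact: xl.
Unshelve. all: by end_near. Qed.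

(** The quadratic form of [J] at the coefficients [1] for [s] and [c] for [t]. *)
Definition quad (J : ckernel R X) (s t : X) (c : R[i]) : R[i] :=
  J s s + c * c^* * J t t + c^* * J t s + c * J s t.

Lemma pd_quad_ge0 (J : ckernel R X) s t c : pd_kernel J -> 0 <= quad J s t c.
Proof.
move=> /(_ 2 (fun i => if i == ord0 then 1 else c) (fun i => if i == ord0 then s else t)).
rewrite !big_ord_recl !big_ord0 /= conjC1 !mul1r !addr0 mulr1.
suff -> : J s s + c * J s t + (c^* * J t s + c^* * c * J t t) = quad J s t c by [].
by rewrite /quad; ring.
Qed.

Lemma quad_polarization (J : ckernel R X) s t :
  J s t = 4^-1 * (quad J s t 1 - quad J s t (-1)
                  - 'i * quad J s t 'i + 'i * quad J s t (- 'i)).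
Proof.
have ii := sqrCi (R[i]).
rewrite /quad !rmorphN !rmorph1 /= conjCi.
by field: ii.
Qed.

Variables (m : nat) (phi : 'I_m -> X -> X) (K : ckernel R X).
Hypotheses (hK : pd_kernel K) (hLK : kernel_le K (pullback phi K)).

Lemma u_bounded s : X_fin phi K s -> exists M, forall n, u_ phi K n s <= M.
Proof.
rewrite /X_fin /= => fin.
have uE : u_oo phi K s = ereal_sup (range (fun n => (u_ phi K n s)%:E)).
  apply/cvg_lim => //; apply: ereal_nondecreasing_cvgn => a b ab.
  by rewrite lee_fin (nd_u hLK).
have le n : ((u_ phi K n s)%:E <= u_oo phi K s)%E.
  by rewrite uE; apply: ereal_sup_ubound; exists n.
exists (fine (u_oo phi K s)) => n.
have fn : u_oo phi K s \is a fin_num.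
  by rewrite ge0_fin_numE //; apply: le_trans (le 0%N); rewrite lee_fin (u_ge0 phi hK).
by rewrite -lee_fin fineK.
Qed.

Lemma Kn_diag n s : Kn phi K n s s = (u_ phi K n s)%:C%C.
Proof. by apply/esym/RRe_real/ger0_real/pd_diag; exact: pd_Kn. Qed.

(** Monotone convergence: the sequence is nondecreasing because [K_(n+1) - K_n]
    is positive definite, and adding the nonnegative value at [- c] cancels the
    off-diagonal terms, which leaves a bound by the diagonal values. *)
Lemma quad_cvg s t c : X_fin phi K s -> X_fin phi K t ->
  cvgn (fun n => quad (Kn phi K n) s t c : R[i]^o).
Proof.
move=> /u_bounded[Ms us] /u_bounded[Mt ut].
have qge n : 0 <= quad (Kn phi K n) s t c by apply/pd_quad_ge0/pd_Kn.
have qE n : (complex.Re (quad (Kn phi K n) s t c))%:C%C = quad (Kn phi K n) s t c.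
  by apply/RRe_real/ger0_real/qge.
have /cvg_ex[l rl] : cvgn (fun n => complex.Re (quad (Kn phi K n) s t c)).
  apply: nondecreasing_is_cvgn.
    apply/nondecreasing_seqP => n; rewrite -lecR !qE -subr_ge0.
    have := pd_quad_ge0 s t c (Kn_le hLK n).
    suff -> : quad (fun s t => Kn phi K n.+1 s t - Kn phi K n s t) s t c =
      quad (Kn phi K n.+1) s t c - quad (Kn phi K n) s t c by [].
    by rewrite /quad; ring.
  pose B := ((Ms%:C)%C + c * c^* * (Mt%:C)%C) *+ 2.
  exists (complex.Re B) => _ [n _ <-].
  have : quad (Kn phi K n) s t c <= B.
    have := pd_quad_ge0 s t (- c) (pd_Kn phi hK n).
    rewrite -(lerDl (quad (Kn phi K n) s t c)) => /le_trans; apply.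
    have -> : quad (Kn phi K n) s t c + quad (Kn phi K n) s t (- c) =
      (Kn phi K n s s + c * c^* * Kn phi K n t t) *+ 2.
      by rewrite /quad rmorphN /=; ring.
    rewrite lerMn2r /= !Kn_diag; apply: lerD; first by rewrite lecR.
    by rewrite ler_wpM2l ?lecR // mul_conjC_ge0.
  by rewrite lecE => /andP[].
apply/cvg_ex; exists (l%:C)%C; have := cvg_real_complex rl.
by under eq_fun do rewrite qE.
Qed.

Lemma cvg_Kn s t : X_fin phi K s -> X_fin phi K t ->
  cvgn (fun n => Kn phi K n s t : R[i]^o).
Proof.
move=> hs ht; under eq_fun do rewrite quad_polarization.
have q c : cvgn (fun n => quad (Kn phi K n) s t c : R[i]^o) by exact: quad_cvg.
apply: (@is_cvgZr _ (R[i]^o)).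
apply: is_cvgD; last by apply: (@is_cvgZr _ (R[i]^o)); exact: q.
apply: is_cvgB; last by apply: (@is_cvgZr _ (R[i]^o)); exact: q.
by apply: is_cvgB; exact: q.
Qed.

(** The first letter of [w] acts first, so each further pullback prepends a
    letter. *)
Lemma Kn_words k n s t : Kn phi K (n + k) s t =
  \sum_(w : n.-tuple 'I_m) Kn phi K k (phiw phi w s) (phiw phi w t).
Proof.
elim: n s t => [|n ih] s t.
  by rewrite (big_pred1 [tuple]) // => w; exact/esym/eqP/tuple0.
have -> : Kn phi K (n.+1 + k) s t =
  \sum_(i < m) Kn phi K (n + k) (phi i s) (phi i t) by [].
under eq_bigr do rewrite ih.
rewrite pair_big /=.
rewrite (reindex (fun p : 'I_m * n.-tuple 'I_m => [tuple of p.1 :: p.2])) //=.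
exists (fun w => (thead w, [tuple of behead w])).
  by move=> [i w] _ /=; congr (_, _); apply: val_inj.
by move=> w _ /=; rewrite -tuple_eta.
Qed.

(** This is [L^n K_oo = K_oo] with the powers of [L] written out over words; it
    is the equality of Gram matrices behind the isometry. *)
Lemma K_oo_words n (s t : X_fin phi K) : K_oo phi K s t =
  \sum_(w : n.-tuple 'I_m) K_oo phi K (phiw_fin hK hLK w s) (phiw_fin hK hLK w t).
Proof.
have cvgK (a b : X_fin phi K) :
    (Kn phi K k (\val a) (\val b) : R[i]^o) @[k --> \oo] --> (K_oo phi K a b : R[i]^o).
  by apply: cvg_Kn; exact: set_mem (valP _).
have := cvgK s t; rewrite -(cvg_shiftn n) => h1.
apply: (cvg_unique (@norm_hausdorff _ (R[i]^o)) h1).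
have -> : (fun k => Kn phi K (k + n) (\val s) (\val t)) =
    (fun k => \sum_(w : n.-tuple 'I_m)
       Kn phi K k (phiw phi w (\val s)) (phiw phi w (\val t))).
  by apply/funext => k; rewrite addnC Kn_words.
apply: (@cvg_big (R[i]^o)); first exact: add_continuous.
by move=> w _; exact: (cvgK (phiw_fin hK hLK w s) (phiw_fin hK hLK w t)).
Qed.

End KernelLimits.

Theorem lemma4p2 (R : realType) (X : Type) (m : nat) (phi : 'I_m -> X -> X)
    (K : ckernel R X) (hm : (1 <= m)%N) (hK : pd_kernel K)
    (hLK : kernel_le K (pullback phi K)) (H : rkhs (K_oo phi K))
    (n : nat) :
  exists V : H -> hilbert_sum H (n.-tuple 'I_m),
    unique (fun V : H -> hilbert_sum H (n.-tuple 'I_m) =>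
      bounded_linear_op V /\
      forall s : X_fin phi K,
        V (rkhs_section H s) =
        [ffun w : n.-tuple 'I_m => rkhs_section H (phiw_fin hK hLK w s)]) V /\
    isometry (hilbert_sum_dot H (n.-tuple 'I_m)) (rkhs_dot H) V /\
    forall f : H, hnorm (hilbert_sum_dot H (n.-tuple 'I_m)) (V f) = `|f|.
Proof.
have normE := @rkhs_normE _ _ _ H.
have total (f : H) : (forall s, rkhs_dot H f (rkhs_section H s) = 0) -> f = 0.
  move=> f0; apply: (@rkhs_eval_inj _ _ _ H); apply/funext => s.
  by rewrite -rkhs_reproducing f0 raddf0.
have dot_sections s t : rkhs_dot H (rkhs_section H s) (rkhs_section H t) = K_oo phi K t s.
  by rewrite rkhs_reproducing rkhs_sectionE.
have [|V [linV Vk isoV]] := gram_isometry normE total (T := n.-tuple 'I_m)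
  (h := fun s => [ffun w : n.-tuple 'I_m => rkhs_section H (phiw_fin hK hLK w s)]).
  move=> s t; rewrite dot_sections (K_oo_words hK hLK n).
  by apply: eq_bigr => w _; rewrite !ffunE dot_sections.
have normV f : hnorm (hilbert_sum_dot H (n.-tuple 'I_m)) (V f) = `|f|.
  by rewrite normE /hnorm isoV.
have boundV : bounded_linear_op V.
  by split=> //; exists 1 => f; rewrite normV mul1r.
exists V; split; last by [].
split=> // V' [[linV' [M' bV']] V'k].
have [_ [M bV]] := boundV.
apply: (bounded_eq_on_sections normE total linV linV' bV bV') => s.
by rewrite Vk V'k.
Qed.
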